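(* Let $T\in\{DPO,SPO_A,SPO_B,SPO_{AB}\}$ and let $\mathcal R^\pm_T\subset\mathcal R_T$ be the subalgebra generated by $\{\hat G\mid G\in\mathcal G_c\}\cup\{\hat G^\dagger\mid G\in\mathcal G_c\}$. (i) For all $G_\alpha,G_\beta\in\mathcal G_c$: $\hat G_\alpha^\dagger*_T\hat G_\beta^\dagger=\hat G_\alpha^\dagger\uplus\hat G_\beta^\dagger$, $\hat G_\alpha*_T\hat G_\beta=\hat G_\alpha\uplus\hat G_\beta$, $\hat G_\alpha^\dagger*_T\hat G_\beta=\hat G_\alpha^\dagger\uplus\hat G_\beta$, and $\hat G_\alpha*_T\hat G_\beta^\dagger=\hat G_\beta^\dagger\uplus\hat G_\alpha+\hat G_\alpha\circledast_T\hat G_\beta^\dagger$. (ii) For all $G,H\in\mathcal G_c$: $$\hat G\circledast_{DPO}\hat H^\dagger=\delta_{G\cong H}\,|\mathrm{Aut}(G)|\,r_\emptyset,$$ $$\hat G\circledast_{SPO_A}\hat H^\dagger=\delta_{G\subseteq H}\sum_m f^{SPO_A}_{GH}{}^{m}\,\widehat{H_m}^\dagger,\qquad H_m:=H\setminus\mathrm{dom}(m),$$ $$\hat G\circledast_{SPO_B}\hat H^\dagger=\delta_{H\subseteq G}\sum_m f^{SPO_B}_{GH}{}^{m}\,\widehat{G_m},\qquad G_m:=G\setminus\mathrm{im}(m),$$ $$\hat G\circledast_{SPO_{AB}}\hat H^\dagger=\sum_m f^{SPO_{AB}}_{GH}{}^{m}\,\widehat{H_m}^\dagger\uplus\widehat{G_m},$$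 where the sums range over the non-trivially contributing matches $m$ and the structure constants $f^T_{GH}{}^m$ are positive integers. (iii) For each $T$, $\mathcal R^\pm_T$ is a non-commutative subalgebra of $\mathcal R_T$.
   Context: $\mathbb K$ is a field (such as $\mathbb R$ or $\mathbb C$). Graphs are finite directed multigraphs (loops allowed). A linear rule $r:I\rightharpoonup O$ is an injective partial graph morphism: a pair of one-to-one relations $r\subseteq(V_I\times V_O)\uplus(E_I\times E_O)$ (distinct pairs differ in both entries) with $(e,e')\in r\Rightarrow(s(e),s(e')),(t(e),t(e'))\in r$ for edges. $[I,O,r]$ denotes its isomorphism class (under pairs of graph isomorphisms of $I$ and of $O$). The vector space underlying the rule algebra $\mathcal R_T$ has as basis the isomorphism classes of linear rules, $\delta([I,O,r])$ being the basis vectors; $r_\emptyset=\delta([\emptyset,\emptyset,\emptyset])$. The superposition $\uplus$ is the bilinear operation given on basis elements by disjoint union of rules. Product. For rules $\rho_1=[I_1,O_1,r_1]$, $\rho_2=[I_2,O_2,r_2]$ a match is a one-to-one relation $m$ from $O_2$ to $I_1$ (vertices to vertices, edges to edges, possibly empty) such that for matched edges $(e,e')\in m$ also $(s(e),s(e')),(t(e),t(e'))\in m$. The composite along $m$ has interfaces $\mathcal I=I_2\uplus(I_1\setminus\mathrm{im}(m))$, $\mathcal O=O_1\uplus(O_2\setminus\mathrm{dom}(m))$ (here only the matched vertices and edges are removed); the relation from $\mathcal I$ to $\mathcal O$ is the restriction of $r_1\cup r_2\cup (r_1\circ m\circ r_2)$. An edge of $I_1$ in $\mathcal I$ whose endpoint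 $v$ is matched, $(v',v)\in m$, gets as endpoint the $w\in I_2$ with $(w,v')\in r_2$ if it exists, and otherwise the endpoint is missing; an edge of $O_2$ in $\mathcal O$ whose endpoint $v'$ is matched, $(v',v)\in m$, gets as endpoint the $w\in O_1$ with $(v,w)\in r_1$ if it exists, and otherwise it is missing; all other endpoints are unchanged. Edges with a missing endpoint are called dangling. Reduction of type $T$: for $DPO$ the composite is replaced by $0$ if there is a dangling edge; for $SPO_A$ dangling edges in $\mathcal O$ are deleted (restricting the relation) and the result is $0$ if there are dangling edges in $\mathcal I$; for $SPO_B$ dangling edges in $\mathcal I$ are deleted and the result is $0$ if there are dangling edges in $\mathcal O$; for $SPO_{AB}$ all dangling edges are deleted. $\delta(\rho_1)*_T\delta(\rho_2)$ is the sum over all matches $m$ of the reduced composites, extended bilinearly; $\mathcal R_T$ is an associative algebra with unit $r_\emptyset$. $x\circledast_T y:=x*_Ty-x\uplus y$ is the contribution of the non-empty matches. Elements. $\mathcal G_c$ is the set of isomorphism classes of (non-empty) connected finite graphs. For a graph $G$: $\hat G:=\delta([G,\emptyset,\emptyset])$, $\hat G^\dagger:=\delta([\emptyset,G,\emptyset])$. In part (ii), matches $m$ are matches for the composition of $\hat G$ with $\hat H^\dagger$, i.e. non-empty injective partial graph morphisms from $H$ to $G$, and ''non-trivially contributing'' means that the reduced composite is non-zero. In the definitions of $H_m$ and $G_m$, $H\setminus\mathrm{dom}(m)$ (resp. $G\setminus\mathrm{im}(m)$) is the graph obtained by deleting all matched vertices and edges together with all edges having one or both endpoints among the deleted vertices.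 $\delta_{G\cong H}$ is $1$ if $G\cong H$ and $0$ otherwise; $\delta_{G\subseteq H}$ is $1$ if $G$ is isomorphic to a (not necessarily proper) subgraph of $H$ and $0$ otherwise. $\mathrm{Aut}(G)$ is the automorphism group of the multigraph $G$ (acting on vertices and edges). *)

(* Defs.v *)
From HB Require Import structures.
From mathcomp Require Import all_boot all_order all_algebra.
From mathcomp Require Import finmap.
From mathcomp Require Export generic_quotient monalg.

Set Implicit Arguments.
Unset Strict Implicit.
Unset Printing Implicit Defensive.

Import GRing.Theory.
Local Open Scope quotient_scope.
Local Open Scope ring_scope.

Reserved Notation "x \star_[ T ] y" (at level 40, left associativity,
  format "x  \star_[ T ]  y").
Reserved Notation "x \ostar_[ T ] y" (at level 40, left associativity,
  format "x  \ostar_[ T ]  y").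
Reserved Notation "x \uplus y" (at level 40, left associativity).

Record graph := Graph {
  vert : finType;
  edge : finType;
  src : edge -> vert;
  tgt : edge -> vert }.

Arguments src {g} _.
Arguments tgt {g} _.

Definition empty_graph : graph :=
  @Graph void void (of_void void) (of_void void).

Definition sum_map (A B A' B' : Type) (f : A -> A') (g : B -> B')
  (x : A + B) : A' + B' :=
  match x with inl a => inl (f a) | inr b => inr (g b) end.

Definition graph_sum (G H : graph) : graph :=
  @Graph (vert G + vert H)%type (edge G + edge H)%type
    (sum_map src src) (sum_map tgt tgt).

(* Reachability is taken in the underlying undirected graph; the empty graph
   does not count as connected. *)
Definition adjacent (G : graph) : rel (vert G) := fun u v =>
  [exists e : edge G, ((src e == u) && (tgt e == v))
                   || ((src e == v) && (tgt e == u))].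

Definition connected_graph (G : graph) : bool :=
  (0 < #|vert G|)%N && [forall u : vert G, forall v : vert G,
                          connect (@adjacent G) u v].

Definition ffun_bij (A B : finType) (f : {ffun A -> B}) : bool :=
  injectiveb f && [forall y, y \in codom f].

Definition isos (G H : graph) :
    {set {ffun vert G -> vert H} * {ffun edge G -> edge H}} :=
  [set f | [&& ffun_bij f.1, ffun_bij f.2 &
     [forall e, (src (f.2 e) == f.1 (src e)) && (tgt (f.2 e) == f.1 (tgt e))]]].

Definition graph_iso (G H : graph) : bool := isos G H != set0.

Definition Aut (G : graph) := isos G G.

Section Subgraphs.
Variables (G : graph) (A : {set vert G}) (B : {set edge G}).

Definition sub_edge (e : edge G) : bool :=
  [&& e \in B, src e \in A & tgt e \in A].

Fact sub_src_subproof (e : {e | sub_edge e}) : src (val e) \in A.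
Proof. by case: e => e /= /and3P[]. Qed.

Fact sub_tgt_subproof (e : {e | sub_edge e}) : tgt (val e) \in A.
Proof. by case: e => e /= /and3P[]. Qed.

(* Edges of B with an endpoint outside A are dropped, so that every pair
   (A, B) gives a subgraph; all subgraphs of G arise in this way. *)
Definition subgraph : graph :=
  @Graph {v | v \in A} {e | sub_edge e}
    (fun e => exist _ (src (val e)) (sub_src_subproof e))
    (fun e => exist _ (tgt (val e)) (sub_tgt_subproof e)).

End Subgraphs.

Definition embeds (G H : graph) : bool :=
  [exists A : {set vert H}, exists B : {set edge H}, graph_iso G (subgraph A B)].

Section Relations.
Variables (A B : finType).
Implicit Type r : {set A * B}.

Definition one_to_one r : bool :=
  [forall p in r, forall q in r, (p.1 == q.1) == (p.2 == q.2)].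

Lemma one_to_oneP r :
  reflect (forall x x' y y', (x, y) \in r -> (x', y') \in r -> x = x' <-> y = y')
          (one_to_one r).
Proof.
apply: (iffP forall_inP) => [h x x' y y' xy xy'|h [x y] xy].
  have /forall_inP/(_ _ xy')/eqP/= e := h _ xy.
  by split=> /eqP; [rewrite e|rewrite -e] => /eqP.
apply/forall_inP=> -[x' y'] xy' /=; have [h1 h2] := h _ _ _ _ xy xy'.
by apply/eqP; apply/eqP/eqP.
Qed.

Definition rdom r : {set A} := [set x | [exists y, (x, y) \in r]].
Definition rim r : {set B} := [set y | [exists x, (x, y) \in r]].

End Relations.

(* Diagrammatic order: first r, then s. *)
Definition rcomp (A B C : finType) (r : {set A * B}) (s : {set B * C}) :
    {set A * C} :=
  [set p | [exists y, ((p.1, y) \in r) && ((y, p.2) \in s)]].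

Lemma rcompP (A B C : finType) (r : {set A * B}) (s : {set B * C}) x z :
  reflect (exists2 y, (x, y) \in r & (y, z) \in s) ((x, z) \in rcomp r s).
Proof.
by rewrite inE; apply: (iffP existsP) => [[y /andP[]]|[y ? ?]]; exists y => //;
  apply/andP.
Qed.

Lemma rcomp_one_to_one (A B C : finType) (r : {set A * B}) (s : {set B * C}) :
  one_to_one r -> one_to_one s -> one_to_one (rcomp r s).
Proof.
move=> /one_to_oneP hr /one_to_oneP hs; apply/one_to_oneP => x x' z z'.
case/rcompP=> y xy yz; case/rcompP=> y' xy' yz'.
by apply: (iff_trans (hr _ _ _ _ xy xy')); apply: hs.
Qed.

Definition prel (G H : graph) : Type :=
  ({set vert G * vert H} * {set edge G * edge H})%type.

Definition is_pmorph (G H : graph) (r : prel G H) : bool :=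
  [&& one_to_one r.1, one_to_one r.2 &
    [forall p in r.2, ((src p.1, src p.2) \in r.1)
                   && ((tgt p.1, tgt p.2) \in r.1)]].

Notation pmorph G H := {r : prel G H | is_pmorph r}.

Definition relV (G H : graph) (r : pmorph G H) := (val r).1.
Definition relE (G H : graph) (r : pmorph G H) := (val r).2.

Section PmorphFacts.
Variables (G H : graph) (r : pmorph G H).

Lemma relV_1to1 : one_to_one (relV r).
Proof. by case/and3P: (valP r). Qed.

Lemma relE_1to1 : one_to_one (relE r).
Proof. by case/and3P: (valP r). Qed.

Lemma rel_src e e' : (e, e') \in relE r -> (src e, src e') \in relV r.
Proof. by case/and3P: (valP r) => _ _ /forall_inP h /h /andP[]. Qed.

Lemma rel_tgt e e' : (e, e') \in relE r -> (tgt e, tgt e') \in relV r.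
Proof. by case/and3P: (valP r) => _ _ /forall_inP h /h /andP[]. Qed.

Definition pmorph_nonempty : bool := (relV r != set0) || (relE r != set0).

End PmorphFacts.

Fact is_pmorph0 (G H : graph) : is_pmorph ((set0, set0) : prel G H).
Proof.
by apply/and3P; split; apply/forall_inP => p; rewrite inE.
Qed.

Definition pmorph0 (G H : graph) : pmorph G H := 
  exist (fun r : prel G H => is_pmorph r) _ (is_pmorph0 G H).

Record rule := Rule {
  rin : graph;
  rout : graph;
  rrel : pmorph rin rout }.

Definition rule_iso (p q : rule) : bool :=
  [exists f in isos (rin p) (rin q), exists g in isos (rout p) (rout q),
    [forall x, forall y,
       ((x, y) \in relV (rrel p)) == ((f.1 x, g.1 y) \in relV (rrel q))]
 && [forall x, forall y,
       ((x, y) \in relE (rrel p)) == ((f.2 x, g.2 y) \in relE (rrel q))]].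

(* Isomorphism classes are formed on the rules between graphs whose vertices
   and edges are ordinals (codes), which form a countable type; every rule is
   isomorphic to a coded one (rule_of_codeK). *)
Definition graph_code : Type :=
  {n : nat & {k : nat & {ffun 'I_k -> 'I_n * 'I_n}}}.

Definition graph_of (c : graph_code) : graph :=
  @Graph 'I_(tag c) 'I_(tag (tagged c))
    (fun e => (tagged (tagged c) e).1) (fun e => (tagged (tagged c) e).2).

Definition code_of_graph (G : graph) : graph_code :=
  existT _ #|vert G| (existT _ #|edge G|
    [ffun i => (enum_rank (src (enum_val i)), enum_rank (tgt (enum_val i)))]).

Definition rule_code : Type :=
  {c : graph_code * graph_code & pmorph (graph_of c.1) (graph_of c.2)}.

HB.instance Definition _ := Choice.on rule_code.

Definition rule_of (c : rule_code) : rule :=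
  @Rule (graph_of (tag c).1) (graph_of (tag c).2) (tagged c).

Section CodeOfRule.
Variable p : rule.

Definition code_prel :
    prel (graph_of (code_of_graph (rin p))) (graph_of (code_of_graph (rout p))) :=
  ([set x : 'I_#|vert (rin p)| * 'I_#|vert (rout p)| |
      (enum_val x.1, enum_val x.2) \in relV (rrel p)],
   [set x : 'I_#|edge (rin p)| * 'I_#|edge (rout p)| |
      (enum_val x.1, enum_val x.2) \in relE (rrel p)]).

Fact code_prel_pmorph : is_pmorph code_prel.
Proof.
apply/and3P; split.
- apply/one_to_oneP=> x x' y y'; rewrite !inE /= => h h'.
  have /one_to_oneP/(_ _ _ _ _ h h')[h1 h2] := relV_1to1 (rrel p).
  by split=> e; apply: enum_val_inj; [apply: h1|apply: h2]; rewrite e.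
- apply/one_to_oneP=> x x' y y'; rewrite !inE /= => h h'.
  have /one_to_oneP/(_ _ _ _ _ h h')[h1 h2] := relE_1to1 (rrel p).
  by split=> e; apply: enum_val_inj; [apply: h1|apply: h2]; rewrite e.
- apply/forall_inP=> -[e e']; rewrite !inE /= !ffunE /= !enum_rankK => h.
  by rewrite rel_src ?rel_tgt.
Qed.

Definition code_of_rule : rule_code :=
  existT _ (code_of_graph (rin p), code_of_graph (rout p))
    (exist (fun r => is_pmorph r) code_prel code_prel_pmorph).

End CodeOfRule.

Definition isom (G H : graph) (f : vert G -> vert H) (g : edge G -> edge H) :=
  [/\ bijective f, bijective g, forall e, src (g e) = f (src e)
    & forall e, tgt (g e) = f (tgt e)].

Lemma ffun_bijP (A B : finType) (f : {ffun A -> B}) :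
  reflect (bijective f) (ffun_bij f).
Proof.
apply: (iffP andP) => [[/injectiveP fi /forallP fs]|[g fK gK]].
  have fs' y : y \in codom f by [].
  by exists (fun y => iinv (fs' y)) => x; [apply: fi; rewrite f_iinv|rewrite f_iinv].
split; first by apply/injectiveP; apply: can_inj fK.
by apply/forallP=> y; rewrite -[y]gK codom_f.
Qed.

Lemma isosP (G H : graph)
    (f : {ffun vert G -> vert H} * {ffun edge G -> edge H}) :
  reflect (@isom G H f.1 f.2) (f \in isos G H).
Proof.
rewrite inE; apply: (iffP and3P) => [[/ffun_bijP ? /ffun_bijP ? /forallP h]|].
  by split=> // e; have /andP[/eqP ? /eqP ?] := h e.
case=> /ffun_bijP ? /ffun_bijP ? h h'; split=> //.
by apply/forallP=> e; rewrite h h' !eqxx.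
Qed.

Definition rule_isom (p q : rule) (f : vert (rin p) -> vert (rin q))
    (f' : edge (rin p) -> edge (rin q)) (g : vert (rout p) -> vert (rout q))
    (g' : edge (rout p) -> edge (rout q)) :=
  [/\ isom f f', isom g g',
      forall x y, ((x, y) \in relV (rrel p)) = ((f x, g y) \in relV (rrel q))
    & forall x y, ((x, y) \in relE (rrel p)) = ((f' x, g' y) \in relE (rrel q))].

Lemma eq_isom (G H : graph) (f f1 : vert G -> vert H) (g g1 : edge G -> edge H) :
  f =1 f1 -> g =1 g1 -> isom f g -> isom f1 g1.
Proof.
move=> ef eg [bf bg hs ht]; split.
- exact: eq_bij bf _ ef.
- exact: eq_bij bg _ eg.
- by move=> e; rewrite -eg -ef hs.
- by move=> e; rewrite -eg -ef ht.
Qed.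

Lemma rule_isoP (p q : rule) :
  reflect (exists f f' g g', @rule_isom p q f f' g g') (rule_iso p q).
Proof.
apply: (iffP exists_inP) => [[f /isosP hf] /exists_inP[g /isosP hg]|].
  case/andP=> /forallP hV /forallP hE.
  exists f.1, f.2, g.1, g.2; split=> // x y; first by have /forallP/(_ y)/eqP := hV x.
  by have /forallP/(_ y)/eqP := hE x.
case=> f [f' [g [g' [hf hg hV hE]]]].
exists (finfun f, finfun f').
  by apply/isosP; apply: eq_isom hf => x; rewrite ffunE.
apply/exists_inP; exists (finfun g, finfun g').
  by apply/isosP; apply: eq_isom hg => x; rewrite ffunE.
by apply/andP; split; apply/forallP=> x; apply/forallP=> y;
  rewrite !ffunE ?hV ?hE.
Qed.

Lemma isom_id (G : graph) : @isom G G id id.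
Proof. by split=> //; exists id. Qed.

Lemma isom_comp (G H L : graph) f f' g g' :
  @isom G H f f' -> @isom H L g g' -> isom (g \o f) (g' \o f').
Proof.
move=> [bf bf' fs ft] [bg bg' gs gt]; split.
- exact: bij_comp.
- exact: bij_comp.
- by move=> e /=; rewrite gs fs.
- by move=> e /=; rewrite gt ft.
Qed.

Lemma isom_inv (G H : graph) f f' g g' : cancel f g -> cancel g f ->
  cancel f' g' -> cancel g' f' -> @isom G H f f' -> @isom H G g g'.
Proof.
move=> fK gK fK' gK' [_ _ fs ft]; split; [by exists f|by exists f'| |].
- by move=> e; apply: (can_inj fK); rewrite -fs gK' gK.
- by move=> e; apply: (can_inj fK); rewrite -ft gK' gK.
Qed.

Lemma rule_iso_refl : reflexive rule_iso.
Proof.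
by move=> p; apply/rule_isoP; exists id, id, id, id; split=> //; apply: isom_id.
Qed.

Lemma rule_iso_imp_sym p q : rule_iso p q -> rule_iso q p.
Proof.
case/rule_isoP=> f [f' [g [g' [hf hg hV hE]]]].
have [[h fK hK] [h' fK' hK'] _ _] := hf; have [[k gK kK] [k' gK' kK'] _ _] := hg.
apply/rule_isoP; exists h, h', k, k'; split.
- exact: isom_inv hf.
- exact: isom_inv hg.
- by move=> x y; rewrite hV hK kK.
- by move=> x y; rewrite hE hK' kK'.
Qed.

Lemma rule_iso_sym : symmetric rule_iso.
Proof. by move=> p q; apply/idP/idP; apply: rule_iso_imp_sym. Qed.

Lemma rule_iso_trans : transitive rule_iso.
Proof.
move=> q p r /rule_isoP[f [f' [g [g' [hf hg hV hE]]]]].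
case/rule_isoP=> h [h' [k [k' [hh hk kV kE]]]].
apply/rule_isoP; exists (h \o f), (h' \o f'), (k \o g), (k' \o g'); split.
- exact: isom_comp hh.
- exact: isom_comp hk.
- by move=> x y; rewrite hV kV.
- by move=> x y; rewrite hE kE.
Qed.

Lemma isom_code (G : graph) :
  @isom G (graph_of (code_of_graph G)) enum_rank enum_rank.
Proof.
by split; rewrite /=; first [exact: enum_rank_bij
  | by move=> e; rewrite ffunE /= enum_rankK].
Qed.

Lemma rule_of_codeK p : rule_iso p (rule_of (code_of_rule p)).
Proof.
apply/rule_isoP.
exists enum_rank, enum_rank, enum_rank, enum_rank.
by split; [exact: isom_code|exact: isom_code| |] => x y;
  rewrite inE /= !enum_rankK.
Qed.

Definition code_iso : rel rule_code := fun c d => rule_iso (rule_of c) (rule_of d).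

Fact code_iso_equiv : equiv_class_of code_iso.
Proof.
split=> [c|c d|d c e]; rewrite /code_iso.
- exact: rule_iso_refl.
- exact: rule_iso_sym.
- exact: rule_iso_trans.
Qed.

Canonical code_iso_equivRel := EquivRelPack code_iso_equiv.

Definition rule_class : Type := {eq_quot code_iso}%qT.
HB.instance Definition _ := Choice.on rule_class.
HB.instance Definition _ := EqQuotient.on rule_class.

Definition class_of_rule (p : rule) : rule_class :=
  (\pi_{eq_quot code_iso} (code_of_rule p))%qT.
Definition rep_rule (c : rule_class) : rule := rule_of (repr c).

Lemma class_of_ruleP p q :
  reflect (class_of_rule p = class_of_rule q) (rule_iso p q).
Proof.
apply: (iffP idP) => [pq|/eqmodP /= e].
  apply/eqmodP; rewrite /= /code_iso.
  apply: rule_iso_trans (rule_iso_trans _ (rule_of_codeK q)).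
    by rewrite rule_iso_sym; apply: rule_of_codeK.
  exact: pq.
apply: rule_iso_trans (rule_of_codeK p) _.
rewrite rule_iso_sym; apply: rule_iso_trans (rule_of_codeK q) _.
by rewrite rule_iso_sym.
Qed.

Lemma rep_ruleP p : rule_iso (rep_rule (class_of_rule p)) p.
Proof.
have /eqmodP/= e := reprK (class_of_rule p).
apply: rule_iso_trans e _; rewrite rule_iso_sym; exact: rule_of_codeK.
Qed.

Section Gluing.
Variables (A2 B2 A1 B1 : finType).
Variables (r2 : {set A2 * B2}) (m : {set B2 * A1}) (r1 : {set A1 * B1}).

Definition glue_in : finType := (A2 + {x | x \notin rim m})%type.
Definition glue_out : finType := (B1 + {y | y \notin rdom m})%type.

(* The vertex that replaces an endpoint x : A1 (resp. y : B2) of an edge of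
   the input (resp. output) interface; None is a missing endpoint. When the
   relations are one-to-one, the element picked is unique. *)
Definition end_in (x : A1) : option glue_in :=
  match (insub x : option {x | x \notin rim m}) with
  | Some u => Some (inr u)
  | None => omap inl [pick w | (w, x) \in rcomp r2 m]
  end.

Definition end_out (y : B2) : option glue_out :=
  match (insub y : option {y | y \notin rdom m}) with
  | Some u => Some (inr u)
  | None => omap inl [pick w | (y, w) \in rcomp m r1]
  end.

Definition glue_rel : {set glue_in * glue_out} :=
  [set p | match p.1, p.2 with
           | inl a, inl b => (a, b) \in rcomp r2 (rcomp m r1)
           | inl a, inr y => (a, val y) \in r2
           | inr x, inl b => (val x, b) \in r1
           | inr _, inr _ => false
           end].

Hypotheses (r2_1 : one_to_one r2) (m_1 : one_to_one m) (r1_1 : one_to_one r1).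

Lemma glue_rel_one_to_one : one_to_one glue_rel.
Proof.
have /one_to_oneP c1 := rcomp_one_to_one r2_1 (rcomp_one_to_one m_1 r1_1).
have /one_to_oneP h2 := r2_1; have /one_to_oneP h1 := r1_1.
have xr a b (y : {y | y \notin rdom m}) :
    (a, b) \in rcomp r2 (rcomp m r1) -> (a, val y) \in r2 -> False.
  case/rcompP=> y' ay' /rcompP[x y'x _] ay; case: y ay => y /= /negP + ay; apply.
  have [/(_ erefl) <- _] := h2 _ _ _ _ ay' ay.
  by rewrite inE; apply/existsP; exists x.
have xl a b (x : {x | x \notin rim m}) :
    (a, b) \in rcomp r2 (rcomp m r1) -> (val x, b) \in r1 -> False.
  case/rcompP=> y' ay' /rcompP[x' y'x x'b] xb; case: x xb => x /= /negP + xb; apply.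
  have [_ /(_ erefl) <-] := h1 _ _ _ _ x'b xb.
  by rewrite inE; apply/existsP; exists y'.
apply/one_to_oneP=> -[a|x] [a'|x'] [b|y] [b'|y']; rewrite !inE //= => h h'.
- by have [i j] := c1 _ _ _ _ h h'; split=> -[e]; congr inl; [apply: i|apply: j].
- by split=> // -[e]; case: (xr _ _ y' h); rewrite e.
- by split=> // -[e]; case: (xr _ _ y h'); rewrite -e.
- have [i j] := h2 _ _ _ _ h h'.
  by split=> -[e]; [congr inr; apply/val_inj/i|congr inl; apply: j; rewrite e].
- by split=> // -[e]; case: (xl _ _ x' h); rewrite e.
- by split=> // -[e]; case: (xl _ _ x h'); rewrite -e.
- have [i j] := h1 _ _ _ _ h h'.
  by split=> -[e]; [congr inl; apply: i; rewrite e|congr inr; apply/val_inj/j].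
Qed.

Lemma end_inP x b z : (x, b) \in r1 -> end_in x = Some z -> (z, inl b) \in glue_rel.
Proof.
rewrite /end_in => xb; case: insubP => [u _ ux [<-]|_]; first by rewrite inE /= ux.
case: pickP => // w /rcompP[y wy yx] [<-]; rewrite inE /=.
by apply/rcompP; exists y => //; apply/rcompP; exists x.
Qed.

Lemma end_outP a y z : (a, y) \in r2 -> end_out y = Some z -> (inl a, z) \in glue_rel.
Proof.
rewrite /end_out => ay; case: insubP => [u _ uy [<-]|_]; first by rewrite inE /= uy.
case: pickP => // w yw [<-]; rewrite inE /=.
by apply/rcompP; exists y.
Qed.

End Gluing.

(* An endpoint equal to None is a missing one. *)
Record pregraph := PreGraph {
  pvert : finType;
  pedge : finType;
  psrc : pedge -> option pvert;
  ptgt : pedge -> option pvert }.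

Arguments psrc {p} _.
Arguments ptgt {p} _.

Definition dangling (P : pregraph) (e : pedge P) : bool :=
  ~~ (isSome (psrc e) && isSome (ptgt e)).

Definition has_dangling (P : pregraph) : bool := [exists e : pedge P, dangling e].

Definition oget (A : Type) (o : option A) : isSome o -> A :=
  match o with
  | Some a => fun _ => a
  | None => fun h => False_rect A (notF h)
  end.

Lemma ogetK (A : Type) (o : option A) (h : isSome o) : o = Some (oget h).
Proof. by case: o h. Qed.

Section Trim.
Variable P : pregraph.

Fact live_src (e : {e : pedge P | ~~ dangling e}) : isSome (psrc (val e)).
Proof. by case: e => e /=; rewrite negbK => /andP[]. Qed.

Fact live_tgt (e : {e : pedge P | ~~ dangling e}) : isSome (ptgt (val e)).
Proof. by case: e => e /=; rewrite negbK => /andP[]. Qed.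

Definition trim : graph :=
  @Graph (pvert P) {e : pedge P | ~~ dangling e}
    (fun e => oget (live_src e)) (fun e => oget (live_tgt e)).

End Trim.

Section Composite.
Variables (p1 p2 : rule) (m : pmorph (rout p2) (rin p1)).

Definition comp_in : pregraph :=
  let ends (f2 : edge (rin p2) -> vert (rin p2))
           (f1 : edge (rin p1) -> vert (rin p1))
           (e : glue_in (edge (rin p2)) (relE m)) :=
    match e with
    | inl e2 => Some (inl (f2 e2))
    | inr e1 => end_in (relV (rrel p2)) (relV m) (f1 (val e1))
    end in
  @PreGraph (glue_in (vert (rin p2)) (relV m)) (glue_in (edge (rin p2)) (relE m))
    (ends src src) (ends tgt tgt).

Definition comp_out : pregraph :=
  let ends (f1 : edge (rout p1) -> vert (rout p1))
           (f2 : edge (rout p2) -> vert (rout p2))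
           (e : glue_out (edge (rout p1)) (relE m)) :=
    match e with
    | inl e1 => Some (inl (f1 e1))
    | inr e2 => end_out (relV m) (relV (rrel p1)) (f2 (val e2))
    end in
  @PreGraph (glue_out (vert (rout p1)) (relV m)) (glue_out (edge (rout p1)) (relE m))
    (ends src src) (ends tgt tgt).

Definition comp_prel : prel (trim comp_in) (trim comp_out) :=
  (glue_rel (relV (rrel p2)) (relV m) (relV (rrel p1)),
   [set e : edge (trim comp_in) * edge (trim comp_out) |
     (val e.1, val e.2) \in glue_rel (relE (rrel p2)) (relE m) (relE (rrel p1))]).

Fact comp_prel_pmorph : is_pmorph comp_prel.
Proof.
apply/and3P; split.
- by apply: glue_rel_one_to_one; apply: relV_1to1.
- have /one_to_oneP h := glue_rel_one_to_one
    (relE_1to1 (rrel p2)) (relE_1to1 m) (relE_1to1 (rrel p1)).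
  apply/one_to_oneP=> x x' y y' xy xy'; rewrite in_set /= in xy.
  rewrite in_set /= in xy'; have [i j] := h _ _ _ _ xy xy'.
  by split=> e; apply: val_inj; [apply: i|apply: j]; rewrite e.
apply/forall_inP=> -[e e']; rewrite inE /=.
move: (live_src e) (live_src e') (live_tgt e) (live_tgt e').
case: e e' => [e he] [e' he'] /= s s' t t'; rewrite inE /=.
move: (ogetK s) (ogetK s') (ogetK t) (ogetK t') => {he he'}.
move: (oget s) (oget s') (oget t) (oget t') => vs vs' vt vt' {s s' t t'}.
case: e e' => [e2|e1] [e1'|e2'] //=.
- move=> [<-] [<-] [<-] [<-] /rcompP[e e2e /rcompP[e' ee' e'e1']].
  apply/andP; split; rewrite in_set /=; apply/rcompP.
  + exists (src e); first exact: rel_src.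
    by apply/rcompP; exists (src e'); apply: rel_src.
  + exists (tgt e); first exact: rel_tgt.
    by apply/rcompP; exists (tgt e'); apply: rel_tgt.
- move=> [<-] s' [<-] t' h; apply/andP; split.
  + by apply: end_outP s'; apply: rel_src.
  + by apply: end_outP t'; apply: rel_tgt.
- move=> s [<-] t [<-] h; apply/andP; split.
  + by apply: end_inP s; apply: rel_src.
  + by apply: end_inP t; apply: rel_tgt.
Qed.

Definition composite : rule :=
  @Rule (trim comp_in) (trim comp_out)
    (exist (fun r => is_pmorph r) comp_prel comp_prel_pmorph).

End Composite.

Section RuleSum.
Variables p q : rule.

Definition rel_sum (A B A' B' : finType) (r : {set A * B}) (s : {set A' * B'}) :
    {set (A + A') * (B + B')} :=
  [set x | match x.1, x.2 with
           | inl a, inl b => (a, b) \in r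
           | inr a, inr b => (a, b) \in s
           | _, _ => false
           end].

Lemma rel_sum_one_to_one (A B A' B' : finType) (r : {set A * B})
    (s : {set A' * B'}) :
  one_to_one r -> one_to_one s -> one_to_one (rel_sum r s).
Proof.
move=> /one_to_oneP hr /one_to_oneP hs.
apply/one_to_oneP=> -[x|x] [x'|x'] [y|y] [y'|y']; rewrite !inE //= => h h'.
- by have [i j] := hr _ _ _ _ h h'; split=> -[e]; congr inl; [apply: i|apply: j].
- by have [i j] := hs _ _ _ _ h h'; split=> -[e]; congr inr; [apply: i|apply: j].
Qed.

Definition sum_prel :
    prel (graph_sum (rin p) (rin q)) (graph_sum (rout p) (rout q)) :=
  (rel_sum (relV (rrel p)) (relV (rrel q)), rel_sum (relE (rrel p)) (relE (rrel q))).

Fact sum_prel_pmorph : is_pmorph sum_prel.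
Proof.
apply/and3P; split.
- by apply: rel_sum_one_to_one; apply: relV_1to1.
- by apply: rel_sum_one_to_one; apply: relE_1to1.
apply/forall_inP=> -[[e|e] [e'|e']]; rewrite !inE //= => h;
  by rewrite rel_src ?rel_tgt.
Qed.

Definition rule_sum : rule :=
  @Rule (graph_sum (rin p) (rin q)) (graph_sum (rout p) (rout q))
    (exist (fun r => is_pmorph r) sum_prel sum_prel_pmorph).

End RuleSum.

Variant rewriting_type := DPO | SPO_A | SPO_B | SPO_AB.

Definition deletes_in (T : rewriting_type) : bool :=
  match T with SPO_B | SPO_AB => true | DPO | SPO_A => false end.
Definition deletes_out (T : rewriting_type) : bool :=
  match T with SPO_A | SPO_AB => true | DPO | SPO_B => false end.

Notation rule_algebra K := {malg K[rule_class]}.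

Section RuleAlgebra.
Variable K : fieldType.
Implicit Types (T : rewriting_type) (x y : rule_algebra K).

Definition delta (p : rule) : rule_algebra K := << class_of_rule p >>.

Definition unit_rule : rule := Rule (pmorph0 empty_graph empty_graph).
Definition r_empty : rule_algebra K := delta unit_rule.

(* The operations on rules used below are invariant under isomorphism, so the
   choice of representatives is immaterial. *)
Definition bilinear_ext (F : rule -> rule -> rule_algebra K) x y :
    rule_algebra K :=
  \sum_(a <- msupp x) \sum_(b <- msupp y)
    (x@_a * y@_b) *: F (rep_rule a) (rep_rule b).

Definition superpose x y : rule_algebra K :=
  bilinear_ext (fun p q => delta (rule_sum p q)) x y.

Definition reduced_composite T (p1 p2 : rule) (m : pmorph (rout p2) (rin p1)) :
    rule_algebra K :=
  if (has_dangling (comp_in m) ==> deletes_in T)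
     && (has_dangling (comp_out m) ==> deletes_out T)
  then delta (composite m) else 0.

Definition rule_mul T x y : rule_algebra K :=
  bilinear_ext (fun p1 p2 =>
    \sum_(m : pmorph (rout p2) (rin p1)) reduced_composite T m) x y.

Definition rule_omul T x y : rule_algebra K := rule_mul T x y - superpose x y.

Definition is_subalgebra T (S : rule_algebra K -> Prop) : Prop :=
  [/\ S r_empty,
      forall (a : K) x y, S x -> S y -> S (a *: x + y)
    & forall x y, S x -> S y -> S (rule_mul T x y)].

Definition generated_subalgebra T (X : rule_algebra K -> Prop) x : Prop :=
  forall S, is_subalgebra T S -> (forall y, X y -> S y) -> S x.

Definition noncommutative T (S : rule_algebra K -> Prop) : Prop :=
  exists x y, [/\ S x, S y & rule_mul T x y <> rule_mul T y x].

Definition del_rule (G : graph) : rule := Rule (pmorph0 G empty_graph).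
Definition cre_rule (G : graph) : rule := Rule (pmorph0 empty_graph G).

Definition hat (G : graph) : rule_algebra K := delta (del_rule G).
Definition hat_dag (G : graph) : rule_algebra K := delta (cre_rule G).

Definition R_pm T : rule_algebra K -> Prop :=
  generated_subalgebra T
    (fun x => exists2 G, connected_graph G & x = hat G \/ x = hat_dag G).

(* Matches for composing hat G with hat_dag H relate H, the output interface
   of cre_rule H, to G, the input interface of del_rule G. *)
Definition contributes T (G H : graph) (m : pmorph H G) : bool :=
  pmorph_nonempty m
  && (@reduced_composite T (del_rule G) (cre_rule H) m != 0).

End RuleAlgebra.

Definition minus_dom (G H : graph) (m : pmorph H G) : graph :=
  @subgraph H (~: rdom (relV m)) (~: rdom (relE m)).
Definition minus_im (G H : graph) (m : pmorph H G) : graph :=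
  @subgraph G (~: rim (relV m)) (~: rim (relE m)).

Notation "x \star_[ T ] y" := (rule_mul T x y) : ring_scope.
Notation "x \ostar_[ T ] y" := (rule_omul T x y) : ring_scope.
Notation "x \uplus y" := (superpose x y) : ring_scope.

(* Main.v *)
(* A match of G-hat with H-hat-dagger is a partial morphism from H to G, and both
rules have an empty interface on the other side, so every edge that loses an
endpoint is dangling and the composite is the rule without relation from the rest
of G to the rest of H. If the rest of a connected graph has no dangling edge after
a non-empty match, the matched vertices are closed under adjacency, so the match
covers the whole graph: it is an embedding of that graph, and an isomorphism when
neither side dangles. Every structure constant can be taken to be 1, as the sums
run over matches and not over isomorphism classes. Non-commutativity is seen on
the one-vertex graph, whose commutator is the unit for every type T. *)
Require Import Defs.
From mathcomp Require Import all_boot all_order all_algebra.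
From mathcomp Require Import finmap.
Set Implicit Arguments.
Unset Strict Implicit.
Unset Printing Implicit Defensive.
Import GRing.Theory.
Local Open Scope ring_scope.

(** * Bijections and isomorphisms of graphs and rules *)

Lemma inj_surj_bij (A B : finType) (f : A -> B) :
  injective f -> (forall y, exists x, f x = y) -> bijective f.
Proof.
move=> fi fs; have fs' y : exists x, f x == y by have [x <-] := fs y; exists x.
exists (fun y => xchoose (fs' y)) => [x|y]; last exact/eqP/(xchooseP (fs' y)).
exact/fi/eqP/(xchooseP (fs' (f x))).
Qed.

Lemma sum_map_bij (A B A' B' : Type) (f : A -> A') (g : B -> B') :
  bijective f -> bijective g -> bijective (sum_map f g).
Proof.
move=> [f' fK fK'] [g' gK gK']; exists (sum_map f' g').
  by case=> x /=; rewrite ?fK ?gK.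
by case=> x /=; rewrite ?fK' ?gK'.
Qed.

Lemma graph_isoP (G H : graph) :
  reflect (exists f g, @isom G H f g) (graph_iso G H).
Proof.
apply: (iffP (set0Pn _)) => [[f /isosP hf]|[f [g h]]].
  by exists f.1, f.2.
exists (finfun f, finfun g); apply/isosP.
by apply: eq_isom h => x; rewrite ffunE.
Qed.

Lemma graph_iso_refl (G : graph) : graph_iso G G.
Proof. by apply/graph_isoP; exists id, id; apply: isom_id. Qed.

Lemma graph_iso_sym (G H : graph) : graph_iso G H -> graph_iso H G.
Proof.
case/graph_isoP=> f [g h]; case: (h) => [[f' fK fK'] [g' gK gK'] _ _].
by apply/graph_isoP; exists f', g'; apply: isom_inv h.
Qed.

Lemma graph_sum_isom (G H G' H' : graph) f f' g g' :
  @isom G G' f f' -> @isom H H' g g' ->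
  @isom (graph_sum G H) (graph_sum G' H') (sum_map f g) (sum_map f' g').
Proof.
move=> [bf bf' fs ft] [bg bg' gs gt]; split; try exact: sum_map_bij.
- by case=> e /=; rewrite ?fs ?gs.
- by case=> e /=; rewrite ?ft ?gt.
Qed.

Definition sum_swap (A B : Type) (x : A + B) : B + A :=
  match x with inl a => inr a | inr b => inl b end.

Lemma graph_sum_swap (G H : graph) :
  @isom (graph_sum G H) (graph_sum H G) (@sum_swap _ _) (@sum_swap _ _).
Proof. by split; try (by exists (@sum_swap _ _); case); case. Qed.

Lemma rule_sum_comm (p q : rule) : rule_iso (rule_sum p q) (rule_sum q p).
Proof.
apply/rule_isoP; do 4 eexists; split; try exact: graph_sum_swap.
- by case=> x [] y; rewrite !inE.
- by case=> x [] y; rewrite !inE.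
Qed.

Lemma rule_sum_iso (p q p' q' : rule) :
  rule_iso p p' -> rule_iso q q' -> rule_iso (rule_sum p q) (rule_sum p' q').
Proof.
case/rule_isoP=> f [f' [g [g' [hf hg hV hE]]]].
case/rule_isoP=> h [h' [k [k' [hh hk kV kE]]]].
apply/rule_isoP; do 4 eexists; split.
- exact: graph_sum_isom hf hh.
- exact: graph_sum_isom hg hk.
- by case=> x [] y; rewrite !inE /= ?hV ?kV.
- by case=> x [] y; rewrite !inE /= ?hE ?kE.
Qed.

(** The common shape of [del_rule], [cre_rule] and every composite of $\hat G$ with $\hat
    H^\dagger$. Its class depends only on the classes of the two graphs, and [rule_sum_null] splits
    it into a creation and a deletion. *)
Definition null_rule (G H : graph) : rule := Rule (pmorph0 G H).

Lemma null_rule_iso (G H G' H' : graph) :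
  graph_iso G G' -> graph_iso H H' -> rule_iso (null_rule G H) (null_rule G' H').
Proof.
case/graph_isoP=> f [f' hf] /graph_isoP[g [g' hg]].
apply/rule_isoP; exists f, f', g, g'; split=> // x y; by rewrite !inE.
Qed.

Lemma graph_iso_empty (G : graph) :
  (vert G -> False) -> graph_iso G empty_graph.
Proof.
move=> G0; apply/graph_isoP.
exists (fun x => match G0 x with end).
exists (fun e => match G0 (src e) with end).
by split; try apply: inj_surj_bij;
  move=> x; try (by case: (G0 (src x))); try (by case: (G0 x)); case: x.
Qed.

Lemma rule_sum_null (G H : graph) :
  rule_iso (rule_sum (cre_rule H) (del_rule G)) (null_rule G H).
Proof.
rewrite rule_iso_sym; apply/rule_isoP; exists inr, inr, inl, inl; split.
- by split=> //; apply: inj_surj_bij => [x y []//|[[]|y]]; exists y.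
- by split=> //; apply: inj_surj_bij => [x y []//|[y|[]]]; exists y.
- by move=> x y; rewrite !inE.
- by move=> x y; rewrite !inE.
Qed.

(** * Empty matches and the composite along them *)

Lemma pmorph_nonemptyE (G H : graph) (m : pmorph G H) :
  pmorph_nonempty m = (m != pmorph0 G H).
Proof.
by rewrite /pmorph_nonempty -negb_and.
Qed.

Lemma pmorph_void (G H : graph) (m : pmorph G H) :
  (vert G -> False) \/ (vert H -> False) -> ~~ pmorph_nonempty m.
Proof.
move=> h; rewrite /pmorph_nonempty negb_or !negbK.
apply/andP; split; apply/eqP/setP => -[x y]; rewrite inE.
  by case: h => h; [case: (h x)|case: (h y)].
by case: h => h; [case: (h (src x))|case: (h (src y))].
Qed.

(** A criterion that avoids the subtype of live edges: the conditions on [psrc] and [ptgt] make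
    every [g e] live, and the last hypothesis makes [g] reach all live edges. The clause on [val]
    lets relations on trimmed edges be compared afterwards. *)
Lemma trim_isom (P : pregraph) (G : graph) (f : vert G -> pvert P)
    (g : edge G -> pedge P) :
  bijective f -> injective g ->
  (forall e, psrc (g e) = Some (f (src e))) ->
  (forall e, ptgt (g e) = Some (f (tgt e))) ->
  (forall e, ~~ dangling e -> exists e', g e' = e) ->
  exists2 g' : edge G -> edge (trim P),
    @isom G (trim P) f g' & forall e, val (g' e) = g e.
Proof.
move=> fb gi gs gt gd.
have gP e : ~~ dangling (g e) by rewrite /dangling gs gt.
exists (fun e => exist _ (g e) (gP e)) => //; split=> // [|e|e].
- apply: inj_surj_bij => [e e' /(congr1 val)/gi//|[e he]].
  by have [e' ee'] := gd e he; exists e'; apply: val_inj.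
- by apply: Some_inj; rewrite /= -ogetK /= gs.
- by apply: Some_inj; rewrite /= -ogetK /= gt.
Qed.

Lemma rim0 (A B : finType) (y : B) : y \notin rim (set0 : {set A * B}).
Proof. by rewrite inE; apply/existsP => -[x]; rewrite inE. Qed.

Lemma rdom0 (A B : finType) (x : A) : x \notin rdom (set0 : {set A * B}).
Proof. by rewrite inE; apply/existsP => -[y]; rewrite inE. Qed.

Lemma end_in_unmatched (A2 B2 A1 : finType) (r2 : {set A2 * B2})
    (m : {set B2 * A1}) x (xm : x \notin rim m) :
  end_in r2 m x = Some (inr (exist _ x xm)).
Proof.
rewrite /end_in; case: insubP => [u _ ux|]; last by rewrite xm.
by congr (Some (inr _)); apply: val_inj.
Qed.

Lemma end_out_unmatched (B2 A1 B1 : finType)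
    (m : {set B2 * A1}) (r1 : {set A1 * B1}) y (ym : y \notin rdom m) :
  end_out m r1 y = Some (inr (exist _ y ym)).
Proof.
rewrite /end_out; case: insubP => [u _ uy|]; last by rewrite ym.
by congr (Some (inr _)); apply: val_inj.
Qed.

(** For the empty match the subtype of unmatched elements is everything; this and [out_right] are
    the resulting identifications with plain disjoint unions. *)
Definition in_right (A B C : finType) (x : A + C) : glue_in A (set0 : {set B * C}) :=
  match x with inl a => inl a | inr c => inr (exist _ c (rim0 B c)) end.

Definition out_right (A B C : finType) (x : A + B) : glue_out A (set0 : {set B * C}) :=
  match x with inl a => inl a | inr b => inr (exist _ b (rdom0 C b)) end.

Lemma in_right_bij (A B C : finType) : bijective (@in_right A B C).
Proof.
apply: inj_surj_bij => [[a|c] [a'|c'] //= []|[a|[c cP]]].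
- by move->.
- by move->.
- by exists (inl a).
- by exists (inr c); congr inr; apply: val_inj.
Qed.

Lemma out_right_bij (A B C : finType) : bijective (@out_right A B C).
Proof.
apply: inj_surj_bij => [[a|c] [a'|c'] //= []|[a|[c cP]]].
- by move->.
- by move->.
- by exists (inl a).
- by exists (inr c); congr inr; apply: val_inj.
Qed.

Section EmptyMatch.
Variables p1 p2 : rule.
Let m0 := pmorph0 (rout p2) (rin p1).

Lemma comp_in0_live (e : pedge (comp_in m0)) : ~~ dangling e.
Proof. by case: e => e; rewrite /dangling //= !end_in_unmatched ?rim0. Qed.

Lemma comp_out0_live (e : pedge (comp_out m0)) : ~~ dangling e.
Proof. by case: e => e; rewrite /dangling //= !end_out_unmatched ?rdom0. Qed.

Lemma composite0 : rule_iso (composite m0) (rule_sum p1 p2).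
Proof.
(* The composite lists its input with [rin p2] first but its output with [rout p1] first. Comparing
   with [rule_sum p2 p1] leaves a swap on the output side only. *)
apply: rule_iso_trans (rule_sum_comm p2 p1); rewrite rule_iso_sym.
have [||||f' hf fE] := @trim_isom (comp_in m0) (graph_sum (rin p2) (rin p1))
  (@in_right _ _ _) (@in_right _ _ _) (in_right_bij _ _ _).
- exact/bij_inj/in_right_bij.
- by case=> e //=; rewrite (end_in_unmatched _ (rim0 _ _)).
- by case=> e //=; rewrite (end_in_unmatched _ (rim0 _ _)).
- move=> e _; have [k _ hk] :=
    in_right_bij (edge (rin p2)) (edge (rout p2)) (edge (rin p1)).
  exists (k e); exact: hk.
have [||||g' hg gE] := @trim_isom (comp_out m0) (graph_sum (rout p1) (rout p2))
  (@out_right _ _ _) (@out_right _ _ _) (out_right_bij _ _ _).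
- exact/bij_inj/out_right_bij.
- by case=> e //=; rewrite (end_out_unmatched _ (rdom0 _ _)).
- by case=> e //=; rewrite (end_out_unmatched _ (rdom0 _ _)).
- move=> e _; have [k _ hk] :=
    out_right_bij (edge (rout p1)) (edge (rout p2)) (edge (rin p1)).
  exists (k e); exact: hk.
(* A pair linking [rin p2] to [rout p1] would have to pass through the empty match. *)
have c0 (A B C D : finType) (r : {set A * B}) (s : {set C * D}) a b :
    ((a, b) \in rcomp r (rcomp set0 s)) = false.
  by apply/rcompP => -[y _ /rcompP[z]]; rewrite inE.
apply/rule_isoP; do 4 eexists; split.
- exact: hf.
- exact: (isom_comp (graph_sum_swap _ _) hg).
- by case=> x [] y; rewrite !inE //= c0.
- by case=> x [] y; rewrite in_set [in RHS]in_set !fE !gE in_set /= ?c0.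
Qed.

End EmptyMatch.

(** * Composites whose outer interfaces are void *)

Definition dangles (G : graph) (A : {set vert G}) (B : {set edge G}) : bool :=
  [exists e in B, ~~ ((src e \in A) && (tgt e \in A))].

Section VoidInterfaces.
Variables (p1 p2 : rule) (m : pmorph (rout p2) (rin p1)).
Hypotheses (out0 : vert (rout p1) -> False) (in0 : vert (rin p2) -> False).

(** A matched endpoint could only be replaced by an element of [A2], and there is none; so it goes
    missing exactly when it is matched. *)
Lemma end_in_void (A2 B2 A1 : finType) (r2 : {set A2 * B2}) (n : {set B2 * A1}) x :
  (A2 -> False) -> isSome (end_in r2 n x) = (x \in ~: rim n).
Proof.
move=> A0; rewrite in_setC; case: (boolP (x \in rim n)) => xn /=.
  by rewrite /end_in insubF ?xn //; case: pickP => // w; case: (A0 w).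
by rewrite (end_in_unmatched _ xn).
Qed.

Lemma end_out_void (B2 A1 B1 : finType) (n : {set B2 * A1}) (r1 : {set A1 * B1}) y :
  (B1 -> False) -> isSome (end_out n r1 y) = (y \in ~: rdom n).
Proof.
move=> B0; rewrite in_setC; case: (boolP (y \in rdom n)) => yn /=.
  by rewrite /end_out insubF ?yn //; case: pickP => // w; case: (B0 w).
by rewrite (end_out_unmatched _ yn).
Qed.

Lemma comp_in_dangling (e : {e | e \notin rim (relE m)}) :
  @dangling (comp_in m) (inr e) =
  ~~ ((src (val e) \in ~: rim (relV m)) && (tgt (val e) \in ~: rim (relV m))).
Proof. by rewrite /dangling /= !end_in_void. Qed.

Lemma comp_out_dangling (e : {e | e \notin rdom (relE m)}) :
  @dangling (comp_out m) (inr e) =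
  ~~ ((src (val e) \in ~: rdom (relV m)) && (tgt (val e) \in ~: rdom (relV m))).
Proof. by rewrite /dangling /= !end_out_void. Qed.

Lemma has_dangling_in :
  has_dangling (comp_in m) = dangles (~: rim (relV m)) (~: rim (relE m)).
Proof.
apply/existsP/exists_inP => [[[e|e]]|[e]].
- by case: (in0 (src e)).
- by rewrite comp_in_dangling => he; exists (val e) => //; rewrite inE (valP e).
- rewrite in_setC => eM he; exists (inr (exist _ e eM)).
  by rewrite comp_in_dangling.
Qed.

Lemma has_dangling_out :
  has_dangling (comp_out m) = dangles (~: rdom (relV m)) (~: rdom (relE m)).
Proof.
apply/existsP/exists_inP => [[[e|e]]|[e]].
- by case: (out0 (src e)).
- by rewrite comp_out_dangling => he; exists (val e) => //; rewrite inE (valP e).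
- rewrite in_setC => eM he; exists (inr (exist _ e eM)).
  by rewrite comp_out_dangling.
Qed.

(** Trimming drops the unmatched edges with a matched endpoint, which are exactly the unmatched
    edges that [subgraph] drops in [minus_im]. *)
Lemma trim_comp_in : graph_iso (minus_im m) (trim (comp_in m)).
Proof.
have VP (v : vert (minus_im m)) : val v \notin rim (relV m).
  by rewrite -in_setC (valP v).
have EP (e : edge (minus_im m)) : val e \notin rim (relE m).
  by case/and3P: (valP e); rewrite in_setC.
have [|||||g' hg _] := @trim_isom (comp_in m) (minus_im m)
  (fun v => inr (exist _ (val v) (VP v))) (fun e => inr (exist _ (val e) (EP e))).
- apply: inj_surj_bij => [v w [] /val_inj//|[v|[v vP]]]; first by case: (in0 v).
  have vP' : v \in ~: rim (relV m) by rewrite in_setC.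
  by exists (exist _ v vP'); congr inr; apply: val_inj.
- by move=> e e' [] /val_inj.
- by move=> e /=; rewrite (end_in_unmatched _ (VP (src e))).
- by move=> e /=; rewrite (end_in_unmatched _ (VP (tgt e))).
- case=> [e|e]; first by case: (in0 (src e)).
  rewrite comp_in_dangling negbK => /andP[sP tP].
  have eP : sub_edge (~: rim (relV m)) (~: rim (relE m)) (val e).
    by rewrite /sub_edge in_setC (valP e) sP tP.
  by exists (exist _ (val e) eP); congr inr; apply: val_inj.
by apply/graph_isoP; eexists; exists g'; apply: hg.
Qed.

Lemma trim_comp_out : graph_iso (minus_dom m) (trim (comp_out m)).
Proof.
have VP (v : vert (minus_dom m)) : val v \notin rdom (relV m).
  by rewrite -in_setC (valP v).
have EP (e : edge (minus_dom m)) : val e \notin rdom (relE m).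
  by case/and3P: (valP e); rewrite in_setC.
have [|||||g' hg _] := @trim_isom (comp_out m) (minus_dom m)
  (fun v => inr (exist _ (val v) (VP v))) (fun e => inr (exist _ (val e) (EP e))).
- apply: inj_surj_bij => [v w [] /val_inj//|[v|[v vP]]]; first by case: (out0 v).
  have vP' : v \in ~: rdom (relV m) by rewrite in_setC.
  by exists (exist _ v vP'); congr inr; apply: val_inj.
- by move=> e e' [] /val_inj.
- by move=> e /=; rewrite (end_out_unmatched _ (VP (src e))).
- by move=> e /=; rewrite (end_out_unmatched _ (VP (tgt e))).
- case=> [e|e]; first by case: (out0 (src e)).
  rewrite comp_out_dangling negbK => /andP[sP tP].
  have eP : sub_edge (~: rdom (relV m)) (~: rdom (relE m)) (val e).
    by rewrite /sub_edge in_setC (valP e) sP tP.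
  by exists (exist _ (val e) eP); congr inr; apply: val_inj.
by apply/graph_isoP; eexists; exists g'; apply: hg.
Qed.

Lemma composite_void : rule_iso (composite m) (null_rule (minus_im m) (minus_dom m)).
Proof.
rewrite rule_iso_sym.
have /graph_isoP[f [f' hf]] := trim_comp_in.
have /graph_isoP[g [g' hg]] := trim_comp_out.
(* The glued relation is empty: a related pair needs an entry in [rin p2] or [rout p1], both void,
   since two unmatched remainders are never related. *)
apply/rule_isoP; exists f, f', g, g'; split=> // [x y|x y]; rewrite !in_set.
  by case: (f x) (g y) => [z|z] [w|w].
by case: (val (f' x)) (val (g' y)) => [z|z] [w|w] //=;
  [case: (in0 (src z))..|case: (out0 (src w))].
Qed.

End VoidInterfaces.

(* This is the condition of reduced_composite, read off G and H alone. *)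
Definition admissible T (G H : graph) (m : pmorph H G) : bool :=
  (dangles (~: rim (relV m)) (~: rim (relE m)) ==> deletes_in T)
  && (dangles (~: rdom (relV m)) (~: rdom (relE m)) ==> deletes_out T).

(** * Basis vectors and the operations on them *)

Lemma eq_delta (K : fieldType) (p q : rule) :
  rule_iso p q -> delta K p = delta K q.
Proof. by move/class_of_ruleP; rewrite /delta => ->. Qed.

Lemma delta_neq0 (K : fieldType) (p : rule) : delta K p != 0.
Proof.
by apply/eqP => /(congr1 (mcoeff (class_of_rule p))) /eqP;
  rewrite mcoeffUU mcoeff0 oner_eq0.
Qed.

Lemma reduced_composite_void (K : fieldType) T (p1 p2 : rule)
    (m : pmorph (rout p2) (rin p1)) :
  (vert (rout p1) -> False) -> (vert (rin p2) -> False) ->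
  reduced_composite K T m =
  if admissible T m then delta K (null_rule (minus_im m) (minus_dom m)) else 0.
Proof.
move=> out0 in0; rewrite /reduced_composite /admissible.
rewrite (has_dangling_in m in0) (has_dangling_out m out0).
by rewrite (eq_delta K (composite_void m out0 in0)).
Qed.

(** A reduced composite is a basis vector or zero, so contributing is a combinatorial condition that
    does not depend on the field. *)
Lemma contributesE (K : fieldType) T (G H : graph) (m : pmorph H G) :
  contributes K T m = pmorph_nonempty m && admissible T m.
Proof.
rewrite /contributes reduced_composite_void; [|by case..].
by case: (admissible T m); rewrite ?delta_neq0 ?eqxx.
Qed.

Lemma reduced_composite0 (K : fieldType) T (p1 p2 : rule) :
  reduced_composite K T (pmorph0 (rout p2) (rin p1)) = delta K (rule_sum p1 p2).
Proof.
have din : has_dangling (comp_in (pmorph0 (rout p2) (rin p1))) = false.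
  by apply/existsP => -[e]; apply/negP/comp_in0_live.
have dout : has_dangling (comp_out (pmorph0 (rout p2) (rin p1))) = false.
  by apply/existsP => -[e]; apply/negP/comp_out0_live.
by rewrite /reduced_composite din dout (eq_delta K (composite0 p1 p2)).
Qed.

Lemma malg_basis_bilinear (K : fieldType) (C : choiceType)
    (F : C -> C -> {malg K[C]}) (a b : C) :
  \sum_(i <- msupp (<< a >> : {malg K[C]}))
    \sum_(j <- msupp (<< b >> : {malg K[C]}))
      ((<< a >> : {malg K[C]})@_i * (<< b >> : {malg K[C]})@_j) *: F i j = F a b.
Proof.
by rewrite !msuppU oner_eq0 !finmap.big_seq_fset1 !mcoeffUU mul1r scale1r.
Qed.
Lemma bilinear_ext_delta (K : fieldType) F (p q : rule) :
  bilinear_ext F (delta K p) (delta K q) =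
  F (rep_rule (class_of_rule p)) (rep_rule (class_of_rule q)).
Proof.
exact: (malg_basis_bilinear (fun a b => F (rep_rule a) (rep_rule b))).
Qed.

Lemma superpose_delta (K : fieldType) (p q : rule) :
  superpose (delta K p) (delta K q) = delta K (rule_sum p q).
Proof.
rewrite /superpose bilinear_ext_delta; apply: eq_delta.
by apply: rule_sum_iso; apply: rep_ruleP.
Qed.

(** Subtracting the superposition cancels exactly the term of the empty match, which no reduction
    type kills. The matches are those of the chosen representatives [p'] and [q'], as the bilinear
    extension evaluates there. *)
Lemma rule_omul_delta (K : fieldType) T (p q : rule)
    (p' := rep_rule (class_of_rule p)) (q' := rep_rule (class_of_rule q)) :
  rule_omul T (delta K p) (delta K q) =
  \sum_(m : pmorph (rout q') (rin p') | pmorph_nonempty m)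
    reduced_composite K T m.
Proof.
rewrite /rule_omul /rule_mul /superpose !bilinear_ext_delta -/p' -/q'.
rewrite (bigD1 (pmorph0 (rout q') (rin p'))) //= reduced_composite0 addrC addrK.
by apply: eq_bigl => m; rewrite pmorph_nonemptyE.
Qed.

(** * Transport of matches along graph isomorphisms *)

Section Pullback.
Variables (G G' H H' : graph).
Variables (f : vert H -> vert H') (f' : edge H -> edge H').
Variables (g : vert G -> vert G') (g' : edge G -> edge G').
Hypotheses (hf : isom f f') (hg : isom g g').

Definition pull_prel (m : pmorph H' G') : prel H G :=
  ([set p | (f p.1, g p.2) \in relV m], [set p | (f' p.1, g' p.2) \in relE m]).

Lemma pull_pmorph m : is_pmorph (pull_prel m).
Proof.
case: hf hg => [bf bf' fs ft] [bg bg' gs gt].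
apply/and3P; split.
- apply/one_to_oneP => x x' y y'; rewrite !inE /= => h h'.
  have /one_to_oneP/(_ _ _ _ _ h h')[i j] := relV_1to1 m.
  by split=> [/(congr1 f)/i/(bij_inj bg)//|/(congr1 g)/j/(bij_inj bf)].
- apply/one_to_oneP => x x' y y'; rewrite !inE /= => h h'.
  have /one_to_oneP/(_ _ _ _ _ h h')[i j] := relE_1to1 m.
  by split=> [/(congr1 f')/i/(bij_inj bg')//|/(congr1 g')/j/(bij_inj bf')].
- by apply/forall_inP => -[e e']; rewrite !inE /= -fs -ft -gs -gt => h;
    rewrite rel_src ?rel_tgt.
Qed.

Definition pull (m : pmorph H' G') : pmorph H G :=
  exist (fun r => is_pmorph r) (pull_prel m) (pull_pmorph m).

End Pullback.

(** The inverse is pullback along the inverse isomorphisms. *)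
Lemma pull_bij (G G' H H' : graph) f f' g g'
    (hf : @isom H H' f f') (hg : @isom G G' g g') : bijective (pull hf hg).
Proof.
have [[fi fK fK'] [fi' eK eK'] _ _] := hf.
have [[gi gK gK'] [gi' kK kK'] _ _] := hg.
have hfi := isom_inv fK fK' eK eK' hf; have hgi := isom_inv gK gK' kK kK' hg.
exists (pull hfi hgi) => m; apply: val_inj; rewrite [RHS]surjective_pairing;
  congr (_, _); apply/setP => -[x y]; rewrite !inE /=.
- by rewrite fK' gK'.
- by rewrite eK' kK'.
- by rewrite fK gK.
- by rewrite eK kK.
Qed.

Lemma subgraph_iso (G H : graph) f f' (A : {set vert G}) (B : {set edge G})
    (A' : {set vert H}) (B' : {set edge H}) :
  @isom G H f f' -> (forall v, (v \in A) = (f v \in A')) ->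
  (forall e, (e \in B) = (f' e \in B')) ->
  graph_iso (subgraph A B) (subgraph A' B').
Proof.
move=> [bf bf' fs ft] hA hB.
have VP (v : vert (subgraph A B)) : f (val v) \in A' by rewrite -hA (valP v).
have sE e : sub_edge A' B' (f' e) = sub_edge A B e.
  by rewrite /sub_edge fs ft -!hA -hB.
have EP (e : edge (subgraph A B)) : sub_edge A' B' (f' (val e)).
  by rewrite sE (valP e).
apply/graph_isoP; exists (fun v => exist _ (f (val v)) (VP v)).
exists (fun e => exist _ (f' (val e)) (EP e)).
have [k _ kK] := bf; have [k' _ kK'] := bf'.
split.
- apply: inj_surj_bij => [v w /(congr1 val)/(bij_inj bf)/val_inj//|[w wP]].
  have vP : k w \in A by rewrite hA kK.
  by exists (exist _ (k w) vP); apply: val_inj; rewrite /= kK.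
- apply: inj_surj_bij => [v w /(congr1 val)/(bij_inj bf')/val_inj//|[w wP]].
  have vP : sub_edge A B (k' w) by rewrite -sE kK'.
  by exists (exist _ (k' w) vP); apply: val_inj; rewrite /= kK'.
- by move=> e; apply: val_inj; rewrite /= fs.
- by move=> e; apply: val_inj; rewrite /= ft.
Qed.

Lemma dangles_iso (G H : graph) f f' (A : {set vert G}) (B : {set edge G})
    (A' : {set vert H}) (B' : {set edge H}) :
  @isom G H f f' -> (forall v, (v \in A) = (f v \in A')) ->
  (forall e, (e \in B) = (f' e \in B')) -> dangles A B = dangles A' B'.
Proof.
move=> [_ [k _ kK] fs ft] hA hB; apply/exists_inP/exists_inP => -[e eB eA].
  by exists (f' e); rewrite -?hB // fs ft -!hA.
by exists (k e); rewrite ?hB ?hA -?fs -?ft kK.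
Qed.

Section PullbackFacts.
Variables (G G' H H' : graph).
Variables (f : vert H -> vert H') (f' : edge H -> edge H').
Variables (g : vert G -> vert G') (g' : edge G -> edge G').
Hypotheses (hf : isom f f') (hg : isom g g').
Variable m : pmorph H' G'.
Let n := pull hf hg m.

Lemma rim_preim (A A' B B' : finType) (h : A -> A') (k : B -> B')
    (r : {set A' * B'}) y : bijective h ->
  (y \in ~: rim [set p : A * B | (h p.1, k p.2) \in r]) = (k y \in ~: rim r).
Proof.
case=> h' _ hK; rewrite !inE; congr negb; apply/existsP/existsP => -[x].
  by rewrite inE => xy; exists (h x).
by move=> xy; exists (h' x); rewrite inE /= hK.
Qed.

Lemma rdom_preim (A A' B B' : finType) (h : A -> A') (k : B -> B')
    (r : {set A' * B'}) x : bijective k ->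
  (x \in ~: rdom [set p : A * B | (h p.1, k p.2) \in r]) = (h x \in ~: rdom r).
Proof.
case=> k' _ kK; rewrite !inE; congr negb; apply/existsP/existsP => -[y].
  by rewrite inE => xy; exists (k y).
by move=> xy; exists (k' y); rewrite inE /= kK.
Qed.

Lemma pull_nonempty : pmorph_nonempty n = pmorph_nonempty m.
Proof.
rewrite !pmorph_nonemptyE; congr negb.
(* The empty match pulls back to the empty match, so injectivity of [pull] settles the claim. *)
have <- : pull hf hg (pmorph0 H' G') = pmorph0 H G.
  by apply: val_inj; congr (_, _); apply/setP => p; rewrite !inE.
by rewrite (bij_eq (pull_bij hf hg)).
Qed.

Lemma pull_admissible T : admissible T n = admissible T m.
Proof.
case: (hf) (hg) => [bf bf' _ _] [bg bg' _ _].
by congr (_ && _); congr (_ ==> _); [apply: (dangles_iso hg)|apply: (dangles_iso hf)];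
  move=> x; rewrite ?rim_preim ?rdom_preim.
Qed.

Lemma pull_minus_im : graph_iso (minus_im n) (minus_im m).
Proof.
by case: (hf) => [bf bf' _ _]; apply: (subgraph_iso hg) => x; rewrite rim_preim.
Qed.

Lemma pull_minus_dom : graph_iso (minus_dom n) (minus_dom m).
Proof.
by case: (hg) => [bg bg' _ _]; apply: (subgraph_iso hf) => x; rewrite rdom_preim.
Qed.

End PullbackFacts.

(** The formula from which all four types are read off; the type enters only through which matches
    contribute. *)
Lemma hat_omul_hat_dag (K : fieldType) T (G H : graph) :
  rule_omul T (hat K G) (hat_dag K H) =
  \sum_(m : pmorph H G | contributes K T m)
    delta K (null_rule (minus_im m) (minus_dom m)).
Proof.
rewrite /hat /hat_dag rule_omul_delta.
case/rule_isoP: (rep_ruleP (del_rule G)) => g [g' [o [_ [hg _ _ _]]]].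
case/rule_isoP: (rep_ruleP (cre_rule H)) => i [_ [f [f' [_ hf _ _]]]].
(* The sum runs over matches between representatives; pulling back indexes it by the matches from
   [H] to [G] themselves. *)
rewrite (reindex (pull hf hg)); last exact/onW_bij/pull_bij.
under eq_bigl do rewrite pull_nonempty.
under [RHS]eq_bigl do rewrite contributesE.
(* Admissibility moves from the index condition into the summand, where it meets the [if] of
   [reduced_composite_void]. *)
rewrite [RHS]big_mkcondr; apply: eq_bigr => m _.
rewrite reduced_composite_void; [|by move=> v; case: (o v)|by move=> v; case: (i v)].
rewrite (pull_admissible hf hg m T).
by rewrite (eq_delta K (null_rule_iso (pull_minus_im hf hg m) (pull_minus_dom hf hg m))).
Qed.

Lemma superpose_hat_dag_hat (K : fieldType) (G H : graph) :
  superpose (hat_dag K H) (hat K G) = delta K (null_rule G H).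
Proof. by rewrite superpose_delta; apply/eq_delta/rule_sum_null. Qed.

(** * Converse matches, total matches and connectedness *)

Lemma converse_one_to_one (A B : finType) (r : {set A * B}) :
  one_to_one r -> one_to_one [set p : B * A | (p.2, p.1) \in r].
Proof.
move=> /one_to_oneP h; apply/one_to_oneP => x x' y y'; rewrite !inE /= => xy xy'.
by apply: iff_sym; apply: h.
Qed.

(** Reversal exchanges domain and image, so that statements on totality need a proof on the domain
    side only. *)
Definition converse_prel (G H : graph) (m : pmorph G H) : prel H G :=
  ([set p | (p.2, p.1) \in relV m], [set p | (p.2, p.1) \in relE m]).

Lemma converse_pmorph (G H : graph) (m : pmorph G H) : is_pmorph (converse_prel m).
Proof.
apply/and3P; split; try (apply: converse_one_to_one; first
  [exact: relV_1to1|exact: relE_1to1]).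
by apply/forall_inP => -[e e']; rewrite !inE /= => h; rewrite rel_src ?rel_tgt.
Qed.

Definition converse (G H : graph) (m : pmorph G H) : pmorph H G :=
  exist (fun r => is_pmorph r) (converse_prel m) (converse_pmorph m).

Section Converse.
Variables (G H : graph) (m : pmorph G H).

Lemma rdomV_converse : rdom (relV (converse m)) = rim (relV m).
Proof. by apply/setP => x; rewrite !inE; apply: eq_existsb => y; rewrite inE. Qed.

Lemma rdomE_converse : rdom (relE (converse m)) = rim (relE m).
Proof. by apply/setP => x; rewrite !inE; apply: eq_existsb => y; rewrite inE. Qed.

Lemma nonempty_converse : pmorph_nonempty m -> pmorph_nonempty (converse m).
Proof.
by case/orP => /set0Pn[[x y] xy]; apply/orP; [left|right]; apply/set0Pn;
  exists (y, x); rewrite inE.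
Qed.

End Converse.

Definition total (G H : graph) (m : pmorph G H) : bool :=
  (rdom (relV m) == setT) && (rdom (relE m) == setT).

Lemma no_dangling_total (G H : graph) (m : pmorph G H) :
  connected_graph G -> pmorph_nonempty m ->
  ~~ dangles (~: rdom (relV m)) (~: rdom (relE m)) -> total m.
Proof.
move=> /andP[_ /forallP Gc] m0 nd.
(* An unmatched edge with a matched endpoint would dangle. *)
have ends e : (src e \in rdom (relV m)) || (tgt e \in rdom (relV m)) ->
    e \in rdom (relE m).
  apply: contraLR => eE; apply: contra nd => eV.
  by apply/exists_inP; exists e; rewrite !in_setC // -negb_or negbK.
have dE e : e \in rdom (relE m) ->
    (src e \in rdom (relV m)) && (tgt e \in rdom (relV m)).
  rewrite inE => /existsP[e' ee']; rewrite !inE.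
  by apply/andP; split; apply/existsP;
    [exists (src e'); apply: rel_src|exists (tgt e'); apply: rel_tgt].
have [u uV] : exists u, u \in rdom (relV m).
  case/orP: m0 => /set0Pn[[x y] xy].
    by exists x; rewrite inE; apply/existsP; exists y.
  (* A match that contains an edge also contains its source, so there is always a matched vertex to
     start from. *)
  exists (src x); rewrite inE; apply/existsP; exists (src y).
  exact: rel_src.
have cl : closed (@adjacent G) (rdom (relV m)).
  apply: intro_closed => [|x y].
    by apply: sym_connect_sym => x y; apply: eq_existsb => e; rewrite orbC.
  case/existsP => e /orP[] /andP[/eqP sx /eqP tx] xV.
    have /dE/andP[_] : e \in rdom (relE m) by apply: ends; rewrite sx xV.
    by rewrite tx.
  have /dE/andP[+ _] : e \in rdom (relE m) by apply: ends; rewrite tx xV orbT.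
  by rewrite sx.
have V v : v \in rdom (relV m).
  by rewrite -(closed_connect cl (forallP (Gc u) v)).
(* Once all vertices are matched, every edge has a matched endpoint and [ends] applies. *)
apply/andP; split; apply/eqP/setP => x; rewrite [RHS]inE ?V //.
by apply: ends; rewrite V.
Qed.

Lemma no_dangling_total_converse (G H : graph) (m : pmorph G H) :
  connected_graph H -> pmorph_nonempty m ->
  ~~ dangles (~: rim (relV m)) (~: rim (relE m)) -> total (converse m).
Proof.
move=> Hc m0 nd; apply: no_dangling_total => //; first exact: nonempty_converse.
by rewrite rdomV_converse rdomE_converse.
Qed.

(** One direction of [one_to_one] makes the chosen partner unique, the other makes the choice
    injective. *)
Lemma total_rel_fun (A B : finType) (r : {set A * B}) :
  one_to_one r -> rdom r = setT ->
  exists f : {ffun A -> B}, injective f /\ forall x y, ((x, y) \in r) = (f x == y).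
Proof.
move=> /one_to_oneP r1 rT.
have rP x : exists y, (x, y) \in r.
  by apply/existsP; have := in_setT x; rewrite -rT inE.
have fP x := xchooseP (rP x).
exists [ffun x => xchoose (rP x)]; split=> [x x'|x y]; rewrite !ffunE.
  by case: (r1 _ _ _ _ (fP x) (fP x')).
apply/idP/eqP => [xy|<-//]; have [/(_ erefl)//] := r1 _ _ _ _ (fP x) xy.
Qed.

Lemma total_pmorph_fun (G H : graph) (m : pmorph G H) : total m ->
  exists (f : {ffun vert G -> vert H}) (f' : {ffun edge G -> edge H}),
  [/\ [/\ injective f, injective f', forall e, src (f' e) = f (src e)
          & forall e, tgt (f' e) = f (tgt e)],
      forall x y, ((x, y) \in relV m) = (f x == y)
    & forall x y, ((x, y) \in relE m) = (f' x == y)].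
Proof.
case/andP => /eqP/(total_rel_fun (relV_1to1 m))[f [fi fE]].
case/eqP/(total_rel_fun (relE_1to1 m)) => f' [fi' fE'].
exists f, f'; split=> //; split=> // e; apply/eqP.
  by rewrite eq_sym -fE rel_src // fE'.
by rewrite eq_sym -fE rel_tgt // fE'.
Qed.

Lemma total_embeds (G H : graph) (m : pmorph G H) : total m -> embeds G H.
Proof.
case/total_pmorph_fun => f [f' [[fi fi' fs ft] fE fE']].
apply/existsP; exists (f @: setT); apply/existsP; exists (f' @: setT).
have VP v : f v \in f @: setT by apply: imset_f.
(* The endpoints of an image edge are image vertices, so the pair of images loses no edge in
   [subgraph]. *)
have EP e : sub_edge (f @: setT) (f' @: setT) (f' e).
  by rewrite /sub_edge fs ft !imset_f.
apply/graph_isoP.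
exists (fun v => exist _ (f v) (VP v)), (fun e => exist _ (f' e) (EP e)); split.
- apply: inj_surj_bij => [x y /(congr1 val)/fi//|[y yP]].
  by have /imsetP[x _ yx] := yP; exists x; apply: val_inj.
- apply: inj_surj_bij => [x y /(congr1 val)/fi'//|[y yP]].
  by have /and3P[/imsetP[x _ yx] _ _] := yP; exists x; apply: val_inj.
- by move=> e; apply: val_inj; rewrite /= fs.
- by move=> e; apply: val_inj; rewrite /= ft.
Qed.

Lemma total_void_rest (G H : graph) (m : pmorph H G) :
  total m -> vert (minus_dom m) -> False.
Proof. by case/andP => /eqP mT _ [v]; rewrite mT setCT inE. Qed.

Lemma total_converse_void_rest (G H : graph) (m : pmorph H G) :
  total (converse m) -> vert (minus_im m) -> False.
Proof. by case/andP; rewrite rdomV_converse => /eqP mT _ [v]; rewrite mT setCT inE. Qed.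

(** * Matches total on both sides and graph isomorphisms *)

Definition graph_rel (G H : graph)
    (f : {ffun vert G -> vert H} * {ffun edge G -> edge H}) : prel G H :=
  ([set p | f.1 p.1 == p.2], [set p | f.2 p.1 == p.2]).

Lemma graph_rel_inj (G H : graph) : injective (@graph_rel G H).
Proof.
move=> [f f'] [g g'] [/setP e /setP e']; congr (_, _); apply/ffunP => x.
  by have := e (x, g x); rewrite !inE /= eqxx => /eqP.
by have := e' (x, g' x); rewrite !inE /= eqxx => /eqP.
Qed.

(** Matches and pairs of finite functions have different types, so they are compared by their images
    in [prel G H]; both maps into it are injective, which turns the equality into one of
    cardinalities. *)
Lemma bitotal_graph_rel (G H : graph) :
  val @: [set m : pmorph G H | total m && total (converse m)] =
  (@graph_rel G H) @: isos G H.
Proof.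
apply/setP => r; apply/imsetP/imsetP => -[].
  move=> m; rewrite inE => /andP[mT cT] ->.
  have [f [f' [[fi fi' fs ft] fE fE']]] := total_pmorph_fun mT.
  exists (f, f').
    (* Totality of [m] gives the injective maps; totality of the converse gives their
       surjectivity. *)
    apply/isosP; split=> //=; apply: inj_surj_bij => // y; case/andP: cT.
      rewrite rdomV_converse => /eqP/setP/(_ y) + _; rewrite !inE.
      by move=> /existsP[x]; rewrite fE => /eqP; exists x.
    rewrite rdomE_converse => _ /eqP/setP/(_ y); rewrite !inE.
    by move=> /existsP[x]; rewrite fE' => /eqP; exists x.
  rewrite [LHS]surjective_pairing; congr (_, _); apply/setP => -[x y].
    by rewrite -/(relV m) fE inE.
  by rewrite -/(relE m) fE' inE.
move=> f /isosP[bf bf' fs ft] ->.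
have rP : is_pmorph (graph_rel f).
  apply/and3P; split.
  - apply/one_to_oneP => x x' y y'; rewrite !inE /= => /eqP <- /eqP <-.
    by split=> [->|/(bij_inj bf)].
  - apply/one_to_oneP => x x' y y'; rewrite !inE /= => /eqP <- /eqP <-.
    by split=> [->|/(bij_inj bf')].
  - by apply/forall_inP => -[e e']; rewrite !inE /= => /eqP <-; rewrite fs ft !eqxx.
exists (exist (fun r => is_pmorph r) _ rP) => //; rewrite inE /total.
rewrite rdomV_converse rdomE_converse.
have [k _ kK] := bf; have [k' _ kK'] := bf'.
by do 2 (apply/andP; split); apply/eqP/setP => x; rewrite !inE; apply/existsP;
  first [by exists (f.1 x); rewrite inE /=|by exists (f.2 x); rewrite inE /=
        |by exists (k x); rewrite inE /= kK|by exists (k' x); rewrite inE /= kK'].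
Qed.

Lemma card_bitotal (G H : graph) :
  #|[set m : pmorph G H | total m && total (converse m)]| = #|isos G H|.
Proof.
by rewrite -(card_imset _ val_inj) bitotal_graph_rel card_imset //; apply: graph_rel_inj.
Qed.

Lemma total_dangles (G H : graph) (m : pmorph G H) :
  total m -> dangles (~: rdom (relV m)) (~: rdom (relE m)) = false.
Proof.
by case/andP=> _ /eqP mT; apply/exists_inP => -[e]; rewrite mT setCT inE.
Qed.

Lemma total_nonempty (G H : graph) (m : pmorph G H) :
  connected_graph G -> total m -> pmorph_nonempty m.
Proof.
case/andP=> /card_gt0P[v _] _ /andP[/eqP mT _]; apply/orP; left.
have := in_setT v; rewrite -mT inE => /existsP[w vw].
by apply/set0Pn; exists (v, w).
Qed.

(** * The contribution of the non-empty matches for each type *)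

Lemma contributes_DPO (K : fieldType) (G H : graph) (m : pmorph H G) :
  connected_graph G -> connected_graph H ->
  contributes K DPO m = total m && total (converse m).
Proof.
move=> Gc Hc; rewrite contributesE /admissible /= !implybF.
apply/and3P/andP => [[m0 ni nd]|[mT cT]].
  by split; [apply: no_dangling_total|apply: no_dangling_total_converse].
split; first exact: total_nonempty.
  by rewrite -rdomV_converse -rdomE_converse total_dangles.
by rewrite total_dangles.
Qed.

Lemma null_rule_void_out (K : fieldType) (G H : graph) :
  (vert H -> False) -> delta K (null_rule G H) = hat K G.
Proof.
move=> H0; apply/eq_delta/null_rule_iso; first exact: graph_iso_refl.
exact: graph_iso_empty.
Qed.

Lemma null_rule_void_in (K : fieldType) (G H : graph) :
  (vert G -> False) -> delta K (null_rule G H) = hat_dag K H.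
Proof.
move=> G0; apply/eq_delta/null_rule_iso; last exact: graph_iso_refl.
exact: graph_iso_empty.
Qed.

Lemma hat_dag_eq (K : fieldType) (G H : graph) :
  graph_iso G H -> hat_dag K G = hat_dag K H.
Proof. by move=> GH; apply/eq_delta/null_rule_iso => //; apply: graph_iso_refl. Qed.

(** Each contributing match covers both graphs, so its composite is the empty rule, and the
    coefficient counts isomorphisms. *)
Lemma hat_omul_DPO_isos (K : fieldType) (G H : graph) :
  connected_graph G -> connected_graph H ->
  rule_omul DPO (hat K G) (hat_dag K H) = #|isos H G|%:R *: r_empty K.
Proof.
move=> Gc Hc; rewrite -card_bitotal hat_omul_hat_dag.
rewrite (eq_bigl (fun m => m \in [set m : pmorph H G | total m && total (converse m)]));
  last by move=> m; rewrite inE contributes_DPO.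
rewrite (eq_bigr (fun _ => r_empty K)); first by rewrite sumr_const scaler_nat.
move=> m; rewrite inE => /andP[mT cT].
by rewrite (eq_delta K (null_rule_iso (graph_iso_empty (total_converse_void_rest cT))
  (graph_iso_empty (total_void_rest mT)))).
Qed.

Lemma hat_omul_DPO (K : fieldType) (G H : graph) :
  connected_graph G -> connected_graph H ->
  rule_omul DPO (hat K G) (hat_dag K H) =
  ((graph_iso G H)%:R * #|Aut G|%:R) *: r_empty K.
Proof.
move=> Gc Hc; case: (boolP (graph_iso G H)) => [GH|nGH].
  (* Replacing [H] by the isomorphic [G] turns the isomorphisms counted into automorphisms. *)
  by rewrite -(hat_dag_eq K GH) hat_omul_DPO_isos // mul1r.
have /negPn/eqP HG0 := contra (@graph_iso_sym H G) nGH.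
by rewrite hat_omul_DPO_isos // HG0 cards0 mul0r.
Qed.

Lemma hat_omul_SPO_A (K : fieldType) (G H : graph) : connected_graph G ->
  rule_omul SPO_A (hat K G) (hat_dag K H) =
  (embeds G H)%:R *: \sum_(m : pmorph H G | contributes K SPO_A m)
                        hat_dag K (minus_dom m).
Proof.
(* The factor [embeds G H] is moved inside the sum: a contributing match has no dangling edge in the
   input, hence embeds all of [G] and makes the factor 1. Without an embedding no match
   contributes. *)
move=> Gc; rewrite hat_omul_hat_dag scaler_sumr; apply: eq_bigr => m.
rewrite contributesE /admissible /= implybF implybT andbT => /andP[m0 ni].
have cT := no_dangling_total_converse Gc m0 ni.
rewrite (total_embeds cT) scale1r null_rule_void_in //.
exact: total_converse_void_rest.
Qed.

Lemma hat_omul_SPO_B (K : fieldType) (G H : graph) : connected_graph H ->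
  rule_omul SPO_B (hat K G) (hat_dag K H) =
  (embeds H G)%:R *: \sum_(m : pmorph H G | contributes K SPO_B m)
                        hat K (minus_im m).
Proof.
(* The mirror image: no edge of the output dangles, so the match embeds [H] in [G] and nothing of
   [H] remains. *)
move=> Hc; rewrite hat_omul_hat_dag scaler_sumr; apply: eq_bigr => m.
rewrite contributesE /admissible /= implybF implybT /= => /andP[m0 nd].
have mT := no_dangling_total Hc m0 nd.
rewrite (total_embeds mT) scale1r null_rule_void_out //.
exact: total_void_rest.
Qed.

Lemma hat_omul_SPO_AB (K : fieldType) (G H : graph) :
  rule_omul SPO_AB (hat K G) (hat_dag K H) =
  \sum_(m : pmorph H G | contributes K SPO_AB m)
     superpose (hat_dag K (minus_dom m)) (hat K (minus_im m)).
Proof.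
by rewrite hat_omul_hat_dag; apply: eq_bigr => m _; rewrite superpose_hat_dag_hat.
Qed.

(** * Products of generators and non-commutativity *)

Lemma superpose_comm (K : fieldType) (p q : rule) :
  superpose (delta K p) (delta K q) = superpose (delta K q) (delta K p).
Proof.
apply: etrans (superpose_delta K p q) _.
exact: etrans (eq_delta K (rule_sum_comm p q)) (esym (superpose_delta K q p)).
Qed.

Lemma rule_mulE (K : fieldType) T (x y : rule_algebra K) :
  rule_mul T x y = superpose x y + rule_omul T x y.
Proof. by rewrite /rule_omul addrC subrK. Qed.

(** Matches relate [rout q] to [rin p]; if either is void, only the empty match exists. Voidness
    passes to the representatives along their isomorphisms. *)
Lemma rule_mul_void (K : fieldType) T (p q : rule) :
  (vert (rout q) -> False) \/ (vert (rin p) -> False) ->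
  rule_mul T (delta K p) (delta K q) = superpose (delta K p) (delta K q).
Proof.
move=> v0; rewrite rule_mulE rule_omul_delta big_pred0 ?addr0 // => m.
case/rule_isoP: (rep_ruleP p) => f [_ [_ [_ [_ _ _ _]]]].
case/rule_isoP: (rep_ruleP q) => [_ [_ [g [_ [_ _ _ _]]]]].
apply/negbTE/pmorph_void.
by case: v0 => v0; [left => /g|right => /f].
Qed.

Definition point : graph := @Graph unit void (of_void unit) (of_void unit).

Lemma point_connected : connected_graph point.
Proof.
rewrite /connected_graph card_unit; apply/forallP => -[]; apply/forallP => -[].
exact: connect0.
Qed.

Lemma card_Aut_point : #|Aut point| = 1%N.
Proof.
have id_in : (finfun id, finfun id) \in Aut point.
  apply/isosP; apply: eq_isom (isom_id point) => x; by rewrite ffunE.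
apply/eqP/cards1P; exists (finfun id, finfun id); apply/setP => -[f g].
rewrite inE; have -> : (f, g) = (finfun id, finfun id).
  by congr (_, _); apply/ffunP => -[]; rewrite ffunE; case: (f tt).
by rewrite eqxx.
Qed.

(** With no edges nothing can dangle, so all types agree with [DPO], where the coefficient is the
    order of a trivial automorphism group. *)
Lemma hat_omul_point (K : fieldType) T :
  rule_omul T (hat K point) (hat_dag K point) = r_empty K.
Proof.
transitivity (rule_omul DPO (hat K point) (hat_dag K point)).
  rewrite !hat_omul_hat_dag; apply: eq_bigl => m; rewrite !contributesE.
  have nd A B : @dangles point A B = false by apply/exists_inP => -[[]].
  by rewrite /admissible !nd.
rewrite hat_omul_DPO ?point_connected // card_Aut_point graph_iso_refl.
by rewrite mul1r scale1r.
Qed.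

Lemma R_pm_subalgebra (K : fieldType) T : is_subalgebra T (@R_pm K T).
Proof.
split=> [S []//|a x y Sx Sy S SS XS|x y Sx Sy S SS XS]; case: (SS) => _ lin mul.
  by apply: lin; [apply: Sx|apply: Sy].
by apply: mul; [apply: Sx|apply: Sy].
Qed.

Lemma R_pm_noncommutative (K : fieldType) T : noncommutative T (@R_pm K T).
Proof.
exists (hat K point), (hat_dag K point); split.
- by move=> S _; apply; exists point; [apply: point_connected|left].
- by move=> S _; apply; exists point; [apply: point_connected|right].
have hd := rule_mulE T (hat K point) (hat_dag K point).
have dh : rule_mul T (hat_dag K point) (hat K point) =
          superpose (hat_dag K point) (hat K point).
  by apply: rule_mul_void; left; case.
move=> eq_mul.
have {eq_mul} := etrans (esym hd) (etrans eq_mul (etrans dh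
  (superpose_comm K (cre_rule point) (del_rule point)))).
(* Cancelling the common superposition would leave [r_empty] equal to 0, but it is a basis vector,
   so this fails in every characteristic. *)
rewrite hat_omul_point -[X in _ = X -> _]addr0 => /addrI/eqP.
exact/negP/delta_neq0.
Qed.

Theorem theorem6p3 (K : fieldType) :
  [/\ forall (T : rewriting_type) (Ga Gb : graph),
        connected_graph Ga -> connected_graph Gb ->
        [/\ hat_dag K Ga \star_[T] hat_dag K Gb = hat_dag K Ga \uplus hat_dag K Gb,
            hat K Ga \star_[T] hat K Gb = hat K Ga \uplus hat K Gb,
            hat_dag K Ga \star_[T] hat K Gb = hat_dag K Ga \uplus hat K Gb
          & hat K Ga \star_[T] hat_dag K Gb
            = hat_dag K Gb \uplus hat K Ga + hat K Ga \ostar_[T] hat_dag K Gb],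
      forall G H : graph, connected_graph G -> connected_graph H ->
        [/\ hat K G \ostar_[DPO] hat_dag K H
            = ((graph_iso G H)%:R * #|Aut G|%:R) *: r_empty K,
            exists f : pmorph H G -> nat,
              (forall m, contributes K SPO_A m -> (0 < f m)%N) /\
              hat K G \ostar_[SPO_A] hat_dag K H
              = (embeds G H)%:R *:
                \sum_(m | contributes K SPO_A m)
                  (f m)%:R *: hat_dag K (minus_dom m),
            exists f : pmorph H G -> nat,
              (forall m, contributes K SPO_B m -> (0 < f m)%N) /\
              hat K G \ostar_[SPO_B] hat_dag K H
              = (embeds H G)%:R *:
                \sum_(m | contributes K SPO_B m)
                  (f m)%:R *: hat K (minus_im m)
          & exists f : pmorph H G -> nat,
              (forall m, contributes K SPO_AB m -> (0 < f m)%N) /\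
              hat K G \ostar_[SPO_AB] hat_dag K H
              = \sum_(m | contributes K SPO_AB m)
                  (f m)%:R *: (hat_dag K (minus_dom m) \uplus hat K (minus_im m))]
    & forall T : rewriting_type,
        is_subalgebra T (@R_pm K T) /\ noncommutative T (@R_pm K T)].
Proof.
split=> [T Ga Gb _ _|G H Gc Hc|T].
- split.
  + by apply: rule_mul_void; right; case.
  + by apply: rule_mul_void; left; case.
  + by apply: rule_mul_void; left; case.
  + apply: etrans (rule_mulE T (hat K Ga) (hat_dag K Gb)) _.
    (* [rule_mulE] gives the superposition in the order of the product, while the claim has the
       creation part first. *)
    have sc := superpose_comm K (del_rule Ga) (cre_rule Gb).
    exact (congr1 (fun z => z + rule_omul T (hat K Ga) (hat_dag K Gb)) sc).
- split; first exact: hat_omul_DPO.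
  + exists (fun _ => 1%N); split=> //; rewrite hat_omul_SPO_A //.
    by under [in RHS]eq_bigr do rewrite scale1r.
  + exists (fun _ => 1%N); split=> //; rewrite hat_omul_SPO_B //.
    by under [in RHS]eq_bigr do rewrite scale1r.
  + exists (fun _ => 1%N); split=> //; rewrite hat_omul_SPO_AB.
    by under [in RHS]eq_bigr do rewrite scale1r.
- by split; [apply: R_pm_subalgebra|apply: R_pm_noncommutative].
Qed.
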